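(* Let $n\ge 2$. The map $\Phi\colon BB_n\to B_n$ defined on generators by $$\sigma_k^{\pm1}\mapsto\sigma_k^{\pm1},\qquad b_{ij}\mapsto A_{ij},\qquad b_{ij}^{(l_1,\dots,l_h)}\mapsto A_{i,l_1}\cdots A_{i,l_h}\,A_{ij}\,A_{i,l_h}^{-1}\cdots A_{i,l_1}^{-1}$$ for $1\le k\le n-1$, $1\le i<j\le n$ and $i<l_1<\dots<l_h<j$, where the $A_{im}$ ($1\le i<m\le n$) are the right pure braid generators, induces a homomorphism of monoids which is surjective but not injective.
   Context: $B_n$ is the Artin braid group with generators $\sigma_1,\dots,\sigma_{n-1}$ and relations $\sigma_i\sigma_j=\sigma_j\sigma_i$ for $|i-j|>1$ and $\sigma_i\sigma_{i+1}\sigma_i=\sigma_{i+1}\sigma_i\sigma_{i+1}$; the right pure braid generators are $A_{ij}=\sigma_i^{-1}\cdots\sigma_{j-2}^{-1}\sigma_{j-1}^2\sigma_{j-2}\cdots\sigma_i\in B_n$, $1\le i<j\le n$. The bonded braid monoid $BB_n$ is the monoid generated by $\sigma_i^{\pm1}$ ($1\le i\le n-1$) and the bonds $b_{ij}^{\mathcal I}$ for $1\le i<j\le n$ and $\mathcal I\subseteq\{i+1,\dots,j-1\}$ (written $b_{ij}^{(l_1,\dots,l_h)}$ when $\mathcal I=\{l_1<\dots<l_h\}$); write $b_{ij}=b_{ij}^{\emptyset}$ and $b_i=b_{i,i+1}$. The defining relations are $\sigma_i\sigma_i^{-1}=\sigma_i^{-1}\sigma_i=1$ and: 1) $\sigma_i\sigma_j=\sigma_j\sigma_i$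 for $|i-j|>1$. 2) $\sigma_i\sigma_{i+1}\sigma_i=\sigma_{i+1}\sigma_i\sigma_{i+1}$ for all $i$. 3) $b_{ij}^{\mathcal I}b_{rs}^{\mathcal R}=b_{rs}^{\mathcal R}b_{ij}^{\mathcal I}$ for $i<j<r<s$ and all $\mathcal I,\mathcal R$. 4) $b_{ij}^{\mathcal I}b_{rs}^{\mathcal R}=b_{rs}^{\mathcal R}b_{ij}^{\mathcal I}$ for $i<r<s<j$ whenever either $r,s\in\mathcal I$ and $\mathcal R\subseteq\mathcal I\cap\{r+1,\dots,s-1\}$, or $r,s\notin\mathcal I$ and $\mathcal I\cap\{r+1,\dots,s-1\}\subseteq\mathcal R$. 5.1) $\sigma_i^{-1}b_{i+1,j}^{\mathcal I}\sigma_i=b_{ij}^{\mathcal I}$ for $j-i>1$, $\mathcal I\subseteq\{i+2,\dots,j-1\}$. 5.2) $\sigma_i b_{i+1,j}^{\mathcal I}\sigma_i^{-1}=b_{ij}^{\{i+1\}\cup\mathcal I}$ for $j-i>1$, $\mathcal I\subseteq\{i+2,\dots,j-1\}$. 5.3) $\sigma_{j-1}b_{i,j-1}^{\mathcal I}\sigma_{j-1}^{-1}=b_{ij}^{\mathcal I}$ for $j-i>1$, $\mathcal I\subseteq\{i+1,\dots,j-2\}$. 5.4) $\sigma_{j-1}^{-1}b_{i,j-1}^{\mathcal I}\sigma_{j-1}=b_{ij}^{\mathcal I\cup\{j-1\}}$ for $j-i>1$, $\mathcal I\subseteq\{i+1,\dots,j-2\}$. 6) $\sigma_ib_i=b_i\sigma_i$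 for $1\le i\le n-1$. 7) $\sigma_ib_{rs}^{\mathcal R}=b_{rs}^{\mathcal R}\sigma_i$ for $i+1<r$ or $i>s$. 8.1) $\sigma_ib_{rs}^{\mathcal R}=b_{rs}^{\mathcal R}\sigma_i$ for $r<i<s-1$ when $i,i+1\in\mathcal R$ or $i,i+1\notin\mathcal R$. 8.2) $\sigma_ib_{rs}^{\mathcal R}=b_{rs}^{\mathcal R'}\sigma_i$ for $r<i<s-1$, where $\mathcal R,\mathcal R'\subseteq\{r+1,\dots,s-1\}$ are equal except that $i\in\mathcal R$, $i+1\notin\mathcal R$, $i\notin\mathcal R'$, $i+1\in\mathcal R'$. 9.1) $b_i\sigma_{i+1}\sigma_i=\sigma_{i+1}\sigma_ib_{i+1}$ for $1\le i<n-1$. 9.2) $\sigma_i\sigma_{i+1}b_i=b_{i+1}\sigma_i\sigma_{i+1}$ for $1\le i<n-1$. (All strand indices in $\{1,\dots,n\}$.) *)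

(* Defs.v *)
From HB Require Import structures.
From mathcomp Require Import all_boot.
From mathcomp Require Import boolp.

Set Implicit Arguments.
Unset Strict Implicit.
Unset Printing Implicit Defensive.

Local Open Scope quotient_scope.
Local Open Scope group_scope.

Inductive congr_closure (X : Type) (R : seq X -> seq X -> Prop) :
    seq X -> seq X -> Prop :=
  | CongrRel u v : R u v -> congr_closure R u v
  | CongrRefl u : congr_closure R u u
  | CongrSym u v : congr_closure R u v -> congr_closure R v u
  | CongrTrans u v w :
      congr_closure R u v -> congr_closure R v w -> congr_closure R u w
  | CongrCat u u' v v' : congr_closure R u u' -> congr_closure R v v' ->
      congr_closure R (u ++ v) (u' ++ v').

Section PresentedMonoid.
Variables (X : choiceType) (R : seq X -> seq X -> Prop).

Definition congr_rel : rel (seq X) := fun u v => `[< congr_closure R u v >].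

Lemma congr_rel_refl : reflexive congr_rel.
Proof. by move=> u; apply/asboolP; exact: CongrRefl. Qed.

Lemma congr_rel_sym : symmetric congr_rel.
Proof. by move=> u v; apply/asboolP/asboolP; exact: CongrSym. Qed.

Lemma congr_rel_trans : transitive congr_rel.
Proof.
move=> v u w /asboolP uv /asboolP vw; apply/asboolP; exact: CongrTrans uv vw.
Qed.

Canonical congr_equiv :=
  EquivRel congr_rel congr_rel_refl congr_rel_sym congr_rel_trans.

(* The monoid < X | u = v for all u, v such that R u v >. *)
Definition presented_monoid := {eq_quot congr_rel}.

HB.instance Definition _ := Choice.on presented_monoid.
HB.instance Definition _ := Quotient.on presented_monoid.

Definition word_class (u : seq X) : presented_monoid := \pi_presented_monoid u.

Lemma word_classP u v : word_class u = word_class v <-> congr_closure R u v.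
Proof.
split; first by move=> /eqmodP /asboolP.
by move=> uv; apply/eqmodP/asboolP.
Qed.

Lemma word_class_repr x : word_class (repr x) = x.
Proof. exact: reprK. Qed.

Definition pm_one : presented_monoid := word_class [::].
Definition pm_mul (x y : presented_monoid) : presented_monoid :=
  word_class (repr x ++ repr y).

Lemma pm_mul_class u v :
  pm_mul (word_class u) (word_class v) = word_class (u ++ v).
Proof.
by apply/word_classP/CongrCat; apply/word_classP; exact: word_class_repr.
Qed.

Lemma pm_mulA : associative pm_mul.
Proof.
move=> x y z.
rewrite -[x]word_class_repr -[y]word_class_repr -[z]word_class_repr.
by rewrite !pm_mul_class catA.
Qed.

Lemma pm_mul1 : left_id pm_one pm_mul.
Proof. by move=> x; rewrite -[x]word_class_repr pm_mul_class. Qed.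

Lemma pm_1mul : right_id pm_one pm_mul.
Proof. by move=> x; rewrite -[x]word_class_repr pm_mul_class cats0. Qed.

HB.instance Definition _ :=
  isMonoid.Build presented_monoid pm_mulA pm_mul1 pm_1mul.

Definition pm_gen (x : X) : presented_monoid := word_class [:: x].

End PresentedMonoid.

(* The letter [(x, true)] stands for [x], and [(x, false)] for its formal
   inverse. *)

Section PresentedGroup.
Variables (X : choiceType) (R : seq (X * bool) -> seq (X * bool) -> Prop).

Inductive group_rel : seq (X * bool) -> seq (X * bool) -> Prop :=
  | GroupRel u v : R u v -> group_rel u v
  | GroupCancel x e : group_rel [:: (x, e); (x, ~~ e)] [::].

Definition presented_group := presented_monoid group_rel.

HB.instance Definition _ := Monoid.on presented_group.

Definition inv_word (u : seq (X * bool)) : seq (X * bool) :=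
  rev [seq (xe.1, ~~ xe.2) | xe <- u].

Lemma inv_word_cat u v : inv_word (u ++ v) = inv_word v ++ inv_word u.
Proof. by rewrite /inv_word map_cat rev_cat. Qed.

Lemma inv_wordK : involutive inv_word.
Proof.
move=> u; rewrite /inv_word map_rev revK -map_comp -[RHS]map_id.
by apply: eq_map => -[x e] /=; rewrite negbK.
Qed.

Lemma word_inv_word u : congr_closure group_rel (u ++ inv_word u) [::].
Proof.
elim: u => [|[x e] u IHu]; first exact: CongrRefl.
rewrite -cat1s inv_word_cat -catA [u ++ _]catA.
apply: (@CongrTrans _ _ _ ([:: (x, e)] ++ inv_word [:: (x, e)])).
  by apply: CongrCat; [exact: CongrRefl | exact: (CongrCat IHu (CongrRefl _ _))].
by apply: CongrRel; exact: GroupCancel.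
Qed.

Definition pg_inv (x : presented_group) : presented_group :=
  word_class group_rel (inv_word (repr x)).

Lemma pg_mulV : right_inverse 1 pg_inv (@mul presented_group).
Proof.
move=> x; rewrite -[X in X * _]word_class_repr.
exact: etrans (pm_mul_class _ _ _) ((word_classP _ _ _).2 (word_inv_word _)).
Qed.

Lemma pg_mulVg : left_inverse 1 pg_inv (@mul presented_group).
Proof.
move=> x; rewrite -[X in _ * X]word_class_repr.
apply: etrans (pm_mul_class _ _ _) ((word_classP _ _ _).2 _).
by rewrite -{2}[repr x]inv_wordK; exact: word_inv_word.
Qed.

HB.instance Definition _ := hasInv.Build presented_group pg_inv.
HB.instance Definition _ :=
  Monoid_isGroup.Build presented_group pg_mulVg pg_mulV.

Definition pg_gen (x : X) : presented_group := pm_gen group_rel (x, true).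

End PresentedGroup.

Section BraidGroup.
Variable n : nat.

Definition braid_index : Type := {i : nat | 0 < i < n}.
HB.instance Definition _ := Choice.on braid_index.

Inductive artin_rel : seq (braid_index * bool) -> seq (braid_index * bool) ->
    Prop :=
  | ArtinComm (i j : braid_index) :
      ((val i).+1 < val j) || ((val j).+1 < val i) ->
      artin_rel [:: (i, true); (j, true)] [:: (j, true); (i, true)]
  | ArtinBraid (i j : braid_index) : val j = (val i).+1 ->
      artin_rel [:: (i, true); (j, true); (i, true)]
                [:: (j, true); (i, true); (j, true)].

Definition braid_group := presented_group artin_rel.
HB.instance Definition _ := Group.on braid_group.

(* Junk value [1] when [i] is not in {1, ..., n - 1}. *)
Definition sigma (i : nat) : braid_group :=
  if (insub i : option braid_index) is Some k then pg_gen artin_rel k else 1.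

(* A_ij = (s_i^-1 ... s_(j-2)^-1) s_(j-1)^2 (s_(j-2) ... s_i), used for
   1 <= i < j <= n; [index_iota i j.-1] is [:: i; ...; j - 2]. *)
Definition pure_gen (i j : nat) : braid_group :=
  (\prod_(k <- index_iota i j.-1) (sigma k)^-1) * sigma j.-1 ^+ 2
  * (\prod_(k <- rev (index_iota i j.-1)) sigma k).

End BraidGroup.

(* The strand set of a bond is encoded by its strictly increasing enumeration
   (see [bond_set]). *)

Inductive bb_letter :=
  | Sigma of bool & nat (* [Sigma true i] is s_i, [Sigma false i] is s_i^-1 *)
  | Bond of nat & nat & seq nat.

Definition bb_letter_code (x : bb_letter) :
    (bool * nat) + (nat * nat * seq nat) :=
  match x with Sigma e i => inl (e, i) | Bond i j J => inr (i, j, J) end.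

Definition bb_letter_decode (c : (bool * nat) + (nat * nat * seq nat)) :
    bb_letter :=
  match c with inl (e, i) => Sigma e i | inr (i, j, J) => Bond i j J end.

Lemma bb_letter_codeK : cancel bb_letter_code bb_letter_decode.
Proof. by case. Qed.

HB.instance Definition _ := Choice.copy bb_letter (can_type bb_letter_codeK).

Definition bond_set (i j : nat) (J : seq nat) : bool :=
  sorted ltn J && all (fun l => i < l < j) J.

Definition bb_valid (n : nat) (x : bb_letter) : bool :=
  match x with
  | Sigma _ i => 0 < i < n
  | Bond i j J => [&& 0 < i, i < j, j <= n & bond_set i j J]
  end.

(* The relations are only imposed between words all of whose letters are
   generators (see [bonded_braid_monoid]); the ranges of the indices that
   express nothing else are therefore not repeated here. *)
Inductive bb_rel : seq bb_letter -> seq bb_letter -> Prop :=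
  | BB_inv e i : bb_rel [:: Sigma e i; Sigma (~~ e) i] [::]
  | BB_1 i j : (i.+1 < j) || (j.+1 < i) ->
      bb_rel [:: Sigma true i; Sigma true j] [:: Sigma true j; Sigma true i]
  | BB_2 i :
      bb_rel [:: Sigma true i; Sigma true i.+1; Sigma true i]
             [:: Sigma true i.+1; Sigma true i; Sigma true i.+1]
  | BB_3 i j r s J R : i < j < r -> r < s ->
      bb_rel [:: Bond i j J; Bond r s R] [:: Bond r s R; Bond i j J]
  | BB_4 i j r s J R : i < r < s -> s < j ->
      [/\ r \in J, s \in J & {subset R <= [seq k <- J | r < k < s]}] \/
      [/\ r \notin J, s \notin J & {subset [seq k <- J | r < k < s] <= R}] ->
      bb_rel [:: Bond i j J; Bond r s R] [:: Bond r s R; Bond i j J]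
  | BB_5_1 i j J : i.+1 < j -> bond_set i.+1 j J ->
      bb_rel [:: Sigma false i; Bond i.+1 j J; Sigma true i] [:: Bond i j J]
  | BB_5_2 i j J : i.+1 < j -> bond_set i.+1 j J ->
      bb_rel [:: Sigma true i; Bond i.+1 j J; Sigma false i]
             [:: Bond i j (i.+1 :: J)]
  | BB_5_3 i j J : i.+1 < j -> bond_set i j.-1 J ->
      bb_rel [:: Sigma true j.-1; Bond i j.-1 J; Sigma false j.-1]
             [:: Bond i j J]
  | BB_5_4 i j J : i.+1 < j -> bond_set i j.-1 J ->
      bb_rel [:: Sigma false j.-1; Bond i j.-1 J; Sigma true j.-1]
             [:: Bond i j (rcons J j.-1)]
  | BB_6 i :
      bb_rel [:: Sigma true i; Bond i i.+1 [::]]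
             [:: Bond i i.+1 [::]; Sigma true i]
  | BB_7 i r s R : (i.+1 < r) || (s < i) ->
      bb_rel [:: Sigma true i; Bond r s R] [:: Bond r s R; Sigma true i]
  | BB_8_1 i r s R : r < i < s.-1 -> (i \in R) = (i.+1 \in R) ->
      bb_rel [:: Sigma true i; Bond r s R] [:: Bond r s R; Sigma true i]
  | BB_8_2 i r s R R' : r < i < s.-1 ->
      [/\ i \in R, i.+1 \notin R, i \notin R' & i.+1 \in R'] ->
      (forall k, k != i -> k != i.+1 -> (k \in R) = (k \in R')) ->
      bb_rel [:: Sigma true i; Bond r s R] [:: Bond r s R'; Sigma true i]
  | BB_9_1 i :
      bb_rel [:: Bond i i.+1 [::]; Sigma true i.+1; Sigma true i]
             [:: Sigma true i.+1; Sigma true i; Bond i.+1 i.+2 [::]]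
  | BB_9_2 i :
      bb_rel [:: Sigma true i; Sigma true i.+1; Bond i i.+1 [::]]
             [:: Bond i.+1 i.+2 [::]; Sigma true i; Sigma true i.+1].

Section BondedBraidMonoid.
Variable n : nat.

Definition bb_generator : Type := {x : bb_letter | bb_valid n x}.
HB.instance Definition _ := Choice.on bb_generator.

Definition bb_gen_rel (u v : seq bb_generator) : Prop :=
  bb_rel (map val u) (map val v).

Definition bonded_braid_monoid := presented_monoid bb_gen_rel.
HB.instance Definition _ := Monoid.on bonded_braid_monoid.

(* Junk value [1] when [x] is not a generator. *)
Definition bb_gen (x : bb_letter) : bonded_braid_monoid :=
  if (insub x : option bb_generator) is Some g then pm_gen bb_gen_rel g else 1.

End BondedBraidMonoid.

(* Main.v *)
(* The bond b_ij^J is sent to the conjugate of A_ij by the inverse of the product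
   of the A_il, l in J.  The relations 5.1-5.4, 8.1 and 8.2 express how the
   sigma_k conjugate the A_il; the only one that is not immediate is 4, where
   the left end of the inner bond b_rs is moved to the right by 5.1 or 5.2 while
   8.1 or 8.2 keeps track of the outer bond, until the inner bond is
   sigma_r^2.  The map is not injective because the relations preserve the
   number of bonds of a word, whereas b_1 and sigma_1^2 have the same image. *)

Require Import Defs.
From HB Require Import structures.
From mathcomp Require Import all_boot.
From mathcomp Require Import zify.

Local Open Scope group_scope.

(** * Homomorphisms out of a presented monoid *)

Section PresentedMonoidLift.
Variables (X : choiceType) (R : seq X -> seq X -> Prop).
Variables (M : monoidType) (f : X -> M).
Hypothesis fR : forall u v, R u v -> \prod_(x <- u) f x = \prod_(x <- v) f x.

Lemma prod_congr u v :
  congr_closure R u v -> \prod_(x <- u) f x = \prod_(x <- v) f x.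
Proof.
elim=> //= {u v} [u v w _ -> _ -> //|u u' v v' _ uE _ vE].
by rewrite !big_cat /= uE vE.
Qed.

(** The value is read off the chosen representative; [prod_congr] makes it independent of that
    choice. *)
Definition presented_lift (x : presented_monoid R) : M :=
  \prod_(y <- repr x) f y.

Lemma presented_lift_class u :
  presented_lift (word_class R u) = \prod_(x <- u) f x.
Proof. by apply/prod_congr/word_classP; exact: word_class_repr. Qed.

Lemma presented_lift1 : presented_lift 1 = 1.
Proof. by rewrite presented_lift_class big_nil. Qed.

Lemma presented_liftM : {morph presented_lift : x y / x * y}.
Proof. by move=> x y; rewrite presented_lift_class big_cat. Qed.

Definition presented_lift_hom :
    UMagmaMorphism.type (presented_monoid R) M :=
  HB.pack presented_lift
    (isMultiplicative.Build (presented_monoid R) M presented_lift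
      presented_liftM)
    (Multiplicative_isUMagmaMorphism.Build (presented_monoid R) M presented_lift
      presented_lift1).

End PresentedMonoidLift.

(** * Commutation and conjugation in a group *)

Lemma commute_conjg (G : groupType) (x y : G) : commute x y <-> x ^ y = x.
Proof.
split=> [xy|xyE]; first by rewrite /conjg xy mulKg.
by rewrite /commute conjgC xyE.
Qed.

Lemma commuteJ (G : groupType) (x y z : G) :
  commute x y -> commute (x ^ z) (y ^ z).
Proof. by rewrite /commute -!conjMg => ->. Qed.

Lemma commuteJV (G : groupType) (x y z : G) :
  commute x z -> commute x y -> commute x (y ^ z).
Proof. by move=> /commute_conjg xz xy; rewrite -xz; apply: commuteJ. Qed.

(** Clearing [y^-1] leaves two words that both equal the square of [x * y * x], the full twist on
    three strands. *)
Lemma braid_commute_sqr (G : groupType) (x y : G) : x * y * x = y * x * y ->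
  commute y (x ^+ 2 * (x ^+ 2) ^ y^-1).
Proof.
move=> xyx; rewrite /commute !expg2 /conjg invgK !mulgA mulgVK.
apply: (canLR (mulgK _)).
have -> : y * x * x * y * x * x = (x * y * x) * (x * y * x).
  by rewrite {1}xyx -!mulgA; congr (_ * (_ * _)); rewrite !mulgA xyx.
by rewrite {2}xyx -!mulgA; congr (_ * _); rewrite !mulgA xyx.
Qed.

(** * Artin generators acting on the pure braid generators *)

Section BraidRelations.
Variable n : nat.
Notation s := (sigma n).
Notation A := (pure_gen n).
Implicit Types p q : pred nat.

Definition braid_word (w : seq (braid_index n * bool)) : braid_group n :=
  word_class (group_rel (artin_rel (n:=n))) w.

Lemma braid_word_cat u v : braid_word (u ++ v) = braid_word u * braid_word v.
Proof. by rewrite [RHS]pm_mul_class. Qed.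

Lemma sigma_word (k : braid_index n) : s (val k) = braid_word [:: (k, true)].
Proof. by rewrite /sigma valK. Qed.

Lemma sigma_junk i : ~~ (0 < i < n) -> s i = 1.
Proof. by move=> ni; rewrite /sigma insubN. Qed.

(** Within the range this is the Artin relation; outside it [sigma] takes the junk value [1], which
    commutes with everything. *)
Lemma sigma_commute i j : (i.+1 < j) || (j.+1 < i) -> commute (s i) (s j).
Proof.
have [ib|/sigma_junk-> _] := boolP (0 < i < n); last exact/commute_sym/commute1.
have [jb|/sigma_junk-> _] := boolP (0 < j < n); last exact: commute1.
rewrite -[i]/(val (Sub i ib : braid_index n)).
rewrite -[j]/(val (Sub j jb : braid_index n)).
rewrite !sigma_word /commute -!braid_word_cat => ij.
by apply/word_classP/CongrRel/GroupRel/ArtinComm.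
Qed.

Lemma sigma_braid i : 0 < i -> i.+1 < n ->
  s i * s i.+1 * s i = s i.+1 * s i * s i.+1.
Proof.
move=> i0 i1n; have ib : 0 < i < n by rewrite i0 ltnW.
rewrite -[i]/(val (Sub i ib : braid_index n)).
rewrite -[(val _).+1]/(val (Sub i.+1 i1n : braid_index n)).
rewrite !sigma_word -!braid_word_cat.
by apply/word_classP/CongrRel/GroupRel/ArtinBraid.
Qed.

Lemma pure_genS i : A i i.+1 = s i ^+ 2.
Proof. by rewrite /pure_gen /index_iota /= subnn /= !big_nil mul1g mulg1. Qed.

(** Peels the outermost letters off the word; this recursion on the left end drives the inductions
    below. *)
Lemma pure_genJl i j : i.+1 < j -> A i j = A i.+1 j ^ s i.
Proof.
move=> ij; rewrite /pure_gen /conjg.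
have -> : index_iota i j.-1 = i :: index_iota i.+1 j.-1.
  by rewrite /index_iota; have -> : j.-1 - i = (j.-1 - i.+1).+1 by lia.
by rewrite rev_cons -cats1 big_cat big_seq1 big_cons /= !mulgA.
Qed.

Lemma commute_pure_gen x i j : i < j ->
  (forall k, i <= k < j -> commute x (s k)) -> commute x (A i j).
Proof.
move=> ij xs; apply: commuteM; first apply: commuteM.
- rewrite big_nat_cond; apply: commute_prod => k ik.
  by apply/commuteV/xs; lia.
- by apply/commuteX/xs; lia.
rewrite big_seq_cond; apply: commute_prod => k.
by rewrite mem_rev mem_index_iota => ik; apply: xs; lia.
Qed.

Lemma sigma_pure_gen_far k i j : (k.+1 < i) || (j < k) -> i < j ->
  commute (s k) (A i j).
Proof.
by move=> kij ij; apply: commute_pure_gen => // m im; apply: sigma_commute; lia.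
Qed.

(** For [j = i + 2] this is the braid relation. Beyond that, conjugations by [s i] and by
    [(s j.-1)^-1] commute, and induction on [j - i] applies. *)
Lemma pure_genJr i j : 0 < i -> i.+1 < j -> j <= n ->
  A i j = A i j.-1 ^ (s j.-1)^-1.
Proof.
move=> i0 ij jn.
elim/ltn_ind: {i}(j - i) {-2}i (erefl (j - i)) i0 ij => d IHd i dE i0 ij.
have [jE|ij1] := eqVneq j i.+2.
  rewrite jE /= pure_genJl // !pure_genS !conjXg; congr (_ ^+ 2).
  rewrite /conjg invgK; apply: (@mulgI _ (s i)); apply: (@mulIg _ (s i.+1)).
  rewrite mulVKg !mulgA mulgVK sigma_braid //; lia.
rewrite pure_genJl // (IHd (j - i.+1)); try lia.
rewrite [A i j.-1]pure_genJl; last lia.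
rewrite -!conjgM; congr (_ ^ _).
by apply/commute_sym/commuteV/sigma_commute; lia.
Qed.

Lemma sigmaJ k : 0 < k -> k.+1 < n -> s k ^ (s k.+1 * s k) = s k.+1.
Proof.
move=> k0 kn; rewrite /conjg; apply: (@mulgI _ (s k.+1 * s k)).
by rewrite mulVKg !mulgA sigma_braid.
Qed.

(** For [k = i + 1], conjugation by [s k * s i] carries [s i] to [s k] and [A i.+2 j] to [A i j],
    and [s i] is far from [A i.+2 j]. Otherwise [s k] commutes with [s i], and the left end can be
    moved to [i.+1]. *)
Lemma sigma_pure_gen_inner k i j : 0 < i < k -> k.+1 < j -> j <= n ->
  commute (s k) (A i j).
Proof.
move=> + kj jn.
elim/ltn_ind: {i}(j - i) {-2}i (erefl (j - i)) => d IHd i dE ik.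
have [kE|ik1] := eqVneq k i.+1.
  rewrite kE pure_genJl; last lia.
  rewrite (@pure_genJl i.+1); last lia.
  rewrite -conjgM -{1}sigmaJ; try lia.
  by apply/commuteJ/sigma_pure_gen_far; lia.
rewrite pure_genJl; last lia.
apply: commuteJV; first by apply: sigma_commute; lia.
by apply: (IHd (j - i.+1)); lia.
Qed.

(** For [k = i + 1] the product is [s i ^+ 2] times its conjugate by [(s k)^-1]. Otherwise both
    factors are conjugates by [s i], which commutes with [s k]. *)
Lemma sigma_pure_gen_mul i k : 0 < i < k -> k < n ->
  commute (s k) (A i k * A i k.+1).
Proof.
move=> + kn.
elim/ltn_ind: {i}(k - i) {-2}i (erefl (k - i)) => d IHd i dE ik.
have [kE|ik1] := eqVneq k i.+1.
  have br : s i * s k * s i = s k * s i * s k by rewrite kE sigma_braid //; lia.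
  rewrite [A i k.+1]pure_genJr; try lia.
  by rewrite kE pure_genS -kE; apply: braid_commute_sqr.
rewrite ![A i _]pure_genJl; try lia.
rewrite -conjMg; apply: commuteJV; first by apply: sigma_commute; lia.
by apply: (IHd (k - i.+1)); lia.
Qed.

(** * Images of bonds and their conjugates by the Artin generators *)

(* The strand set of a bond enters as a predicate, which spares sorting the
   enumeration again when strands are exchanged. *)
Definition bond_prod i j (p : pred nat) : braid_group n :=
  \prod_(i.+1 <= l < j | p l) A i l.

Definition bond_braid i j p : braid_group n := A i j ^ (bond_prod i j p)^-1.

Lemma eq_prod_nat_cond (F : nat -> braid_group n) a b p q :
    (forall l, a <= l < b -> p l = q l) ->
  \prod_(a <= l < b | p l) F l = \prod_(a <= l < b | q l) F l.
Proof.
move=> pq; rewrite big_nat_cond [RHS]big_nat_cond; apply: eq_bigl => l.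
by apply: andb_id2l => /pq->.
Qed.

Lemma eq_bond_braid i j p q : (forall l, i < l < j -> p l = q l) ->
  bond_braid i j p = bond_braid i j q.
Proof.
move=> pq; have pqE : bond_prod i j p = bond_prod i j q.
  exact: eq_prod_nat_cond.
by rewrite /bond_braid pqE.
Qed.

Lemma bond_braidS i p : bond_braid i i.+1 p = s i ^+ 2.
Proof. by rewrite /bond_braid /bond_prod big_geq // invg1 conjg1 pure_genS. Qed.

Lemma commute_bond_braid x i j p : i < j ->
  (forall k, i <= k < j -> commute x (s k)) -> commute x (bond_braid i j p).
Proof.
move=> ij xs; apply: commuteJV; last exact: commute_pure_gen.
rewrite /bond_prod big_nat_cond; apply/commuteV/commute_prod => l il.
by apply: commute_pure_gen => [|k ik]; [|apply: xs]; lia.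
Qed.

Lemma sigma_bond_far k i j p : (k.+1 < i) || (j < k) -> i < j ->
  commute (s k) (bond_braid i j p).
Proof.
by move=> kij ij; apply: commute_bond_braid => // m im; apply: sigma_commute; lia.
Qed.

(** The membership of [i.+1] becomes a boolean exponent; all later factors [A i l] are conjugates by
    [s i]. *)
Lemma bond_prodJl i j p : i.+1 < j ->
  bond_prod i j p = A i i.+1 ^+ p i.+1 * bond_prod i.+1 j p ^ s i.
Proof.
move=> ij; rewrite /bond_prod conjg_prod big_mkcond big_ltn // -big_mkcond /=.
rewrite expgb big_nat_cond [X in _ = _ * X]big_nat_cond; congr (_ * _).
by apply: eq_bigr => l /andP[il _]; rewrite -pure_genJl //; lia.
Qed.

Lemma bond_braidJl i j p : i.+1 < j -> ~~ p i.+1 ->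
  bond_braid i j p = bond_braid i.+1 j p ^ s i.
Proof.
move=> ij /negbTE pi; rewrite /bond_braid bond_prodJl // pi mul1g pure_genJl //.
by rewrite -conjVg -conjJg.
Qed.

(** The leading factor [A i i.+1] is [s i ^+ 2], and conjugation by its inverse turns conjugation by
    [s i] into conjugation by [(s i)^-1]. *)
Lemma bond_braidJVl i j p : i.+1 < j -> p i.+1 ->
  bond_braid i j p = bond_braid i.+1 j p ^ (s i)^-1.
Proof.
move=> ij pi; rewrite /bond_braid bond_prodJl // pi expg1 pure_genJl //.
rewrite invgM conjgM -conjVg -conjJg pure_genS -conjgM; congr (_ ^ _).
by rewrite expg2 invgM mulVKg.
Qed.

Lemma sigma_bond_prod_far i j p : commute (s j) (bond_prod i j p).
Proof.
rewrite /bond_prod big_nat_cond; apply: commute_prod => l lij.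
by apply: sigma_pure_gen_far; lia.
Qed.

Lemma bond_prodr i j p : i.+1 < j ->
  bond_prod i j p = bond_prod i j.-1 p * A i j.-1 ^+ p j.-1.
Proof.
case: j => // j ij; rewrite /bond_prod /= big_mkcond big_nat_recr //= expgb.
by rewrite -big_mkcond.
Qed.

Lemma bond_braidJVr i j p : 0 < i -> i.+1 < j -> j <= n -> ~~ p j.-1 ->
  bond_braid i j p = bond_braid i j.-1 p ^ (s j.-1)^-1.
Proof.
move=> i0 ij jn /negbTE pj; rewrite /bond_braid bond_prodr // pj mulg1.
rewrite pure_genJr // -!conjgM; congr (_ ^ _).
by rewrite -!invgM; congr _^-1; apply/commute_sym/sigma_bond_prod_far.
Qed.

Lemma bond_braidJr i j p : 0 < i -> i.+1 < j -> j <= n -> p j.-1 ->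
  bond_braid i j p = bond_braid i j.-1 p ^ s j.-1.
Proof.
move=> i0 ij jn pj; rewrite /bond_braid bond_prodr // pj expg1 invgM conjgM.
(* Conjugation by [s j.-1] fixes [A i j.-1 * A i j] and sends its second factor to [A i j.-1]. *)
have -> : A i j ^ (A i j.-1)^-1 = A i j.-1 ^ s j.-1.
  have := @sigma_pure_gen_mul i j.-1; rewrite prednK; last lia.
  move=> /(_ ltac:(lia) ltac:(lia)) /commute_sym/commute_conjg.
  rewrite (conjMg _ (A i j)) {1}(@pure_genJr i j) // conjgKV => AE.
  by rewrite /conjg invgK mulgA -AE mulgK.
rewrite -!conjgM; congr (_ ^ _).
exact/commuteV/sigma_bond_prod_far.
Qed.

Lemma bond_prod_split i j p k : i < k -> k.+1 < j ->
  bond_prod i j p = \prod_(i.+1 <= l < k | p l) A i l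
    * (A i k ^+ p k * A i k.+1 ^+ p k.+1) * \prod_(k.+2 <= l < j | p l) A i l.
Proof.
move=> ik kj; rewrite /bond_prod (@big_cat_nat _ _ _ k) //=; last lia.
rewrite [X in _ * X = _]big_mkcond big_ltn; last lia.
rewrite [X in _ * (_ * X) = _]big_ltn; last lia.
by rewrite -big_mkcond -!expgb !mulgA.
Qed.

(** Only the factors at [k] and [k.+1] can change: [s k] is far from [A i l] for [l < k], and acts
    strictly between its ends for [l > k.+1]. *)
Lemma bond_prodJV_split i j p k : 0 < i < k -> k.+1 < j -> j <= n ->
  bond_prod i j p ^ (s k)^-1 = \prod_(i.+1 <= l < k | p l) A i l
    * (A i k ^+ p k * A i k.+1 ^+ p k.+1) ^ (s k)^-1
    * \prod_(k.+2 <= l < j | p l) A i l.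
Proof.
move=> ik kj jn; rewrite (@bond_prod_split _ _ _ k); try lia.
have out m1 m2 : i < m1 -> m2 <= j -> (m2 <= k) || (k.+1 < m1) ->
    (\prod_(m1 <= l < m2 | p l) A i l) ^ (s k)^-1 =
    \prod_(m1 <= l < m2 | p l) A i l.
  move=> im1 m2j mk; apply/commute_conjg/commuteV/commute_sym.
  rewrite big_nat_cond; apply: commute_prod => l /andP[lm _].
  have [lk|kl] := ltnP l k; first by apply: sigma_pure_gen_far; lia.
  by apply: sigma_pure_gen_inner; lia.
by rewrite !conjMg !out //; lia.
Qed.

(** Since [s k] commutes with [A i j], the conjugation acts on the conjugating product alone. *)
Lemma bond_braidJV i j p k : 0 < i < k -> k.+1 < j -> j <= n ->
  bond_braid i j p ^ (s k)^-1 = A i j ^ (bond_prod i j p ^ (s k)^-1)^-1.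
Proof.
move=> ik kj jn; rewrite /bond_braid conjJg conjVg; congr (_ ^ _).
exact/commute_conjg/commuteV/commute_sym/sigma_pure_gen_inner.
Qed.

(** The middle factor of the product is either [1] or [A i k * A i k.+1], and both commute with
    [s k]. *)
Lemma sigma_bond_commute i j p k : 0 < i < k -> k.+1 < j -> j <= n ->
  p k = p k.+1 -> commute (s k) (bond_braid i j p).
Proof.
move=> ik kj jn pk; rewrite -[s k]invgK; apply/commute_sym/commuteV.
apply/commute_conjg; rewrite bond_braidJV // bond_prodJV_split //.
have -> : (A i k ^+ p k * A i k.+1 ^+ p k.+1) ^ (s k)^-1
    = A i k ^+ p k * A i k.+1 ^+ p k.+1.
  rewrite pk; case: (p k.+1); last by rewrite mulg1 conj1g.
  apply/commute_conjg/commuteV/commute_sym/sigma_pure_gen_mul; lia.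
by rewrite -bond_prod_split //; lia.
Qed.

(** The middle factor [A i k] is conjugated to [A i k.+1] by [pure_genJr]. *)
Lemma sigma_bond_swap i j p q k : 0 < i < k -> k.+1 < j -> j <= n ->
    [/\ p k, ~~ p k.+1, ~~ q k & q k.+1] ->
    (forall l, l != k -> l != k.+1 -> p l = q l) ->
  bond_braid i j p ^ (s k)^-1 = bond_braid i j q.
Proof.
move=> ik kj jn [pk /negbTE pk1 /negbTE qk qk1] pq.
rewrite bond_braidJV // bond_prodJV_split // /bond_braid.
rewrite (@bond_prod_split _ _ q k) //; last lia.
rewrite pk pk1 qk qk1 !expg0 !expg1 mulg1 mul1g.
rewrite -(@pure_genJr _ k.+1) //; try lia.
rewrite (@eq_prod_nat_cond _ i.+1 k p q) => [|l lk]; last by apply: pq; lia.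
rewrite (@eq_prod_nat_cond _ k.+2 j p q) // => l lk; apply: pq; lia.
Qed.

(* Relation 4: its two cases are [b = true] and [b = false]. *)
Lemma nested_bond_commute (b : bool) i j p r t q : 0 < i < r -> r < t < j ->
    j <= n -> p r = b -> p t = b ->
    (forall k, r < k < t -> q k = b -> p k = b) ->
  commute (bond_braid i j p) (bond_braid r t q).
Proof.
move=> + + jn.
(* Induction on the length of the inner bond; [p] is generalised because the outer strand set may
   change when [r] moves. *)
elim/ltn_ind: {r}(t - r) {-2}r p (erefl (t - r)) => d IHd r p dE ir rt pr pt pq.
have [tE|tr1] := eqVneq t r.+1.
  rewrite tE bond_braidS.
  by apply/commuteX/commute_sym/sigma_bond_commute; try lia; rewrite pr -pt tE.
have {tr1 rt} rt : r.+1 < t < j by lia.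
have IH p' : p' r.+1 = b -> p' t = b ->
    (forall k, r.+1 < k < t -> q k = b -> p' k = b) ->
    commute (bond_braid i j p') (bond_braid r.+1 t q).
  by apply: (IHd (t - r.+1)); lia.
have [pr1|pr1] := eqVneq (p r.+1) b.
  have Bs : commute (bond_braid i j p) (s r).
    by apply/commute_sym/sigma_bond_commute; try lia; rewrite pr pr1.
  have BB : commute (bond_braid i j p) (bond_braid r.+1 t q).
    by apply: IH => // k rk; apply: pq; lia.
  have [qr|qr] := boolP (q r.+1).
    rewrite (@bond_braidJVl r) //; last lia.
    by apply: commuteJV; [exact: commuteV | exact: BB].
  by rewrite (@bond_braidJl r) //; [exact: commuteJV | lia].
(* Now [p r = b] and [p r.+1 = ~~ b]. The value of [q r.+1] forced by [pq] makes the inner bond a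
   conjugate by [s r] or its inverse in exactly the direction that exchanges [r] and [r.+1] in the
   outer bond. *)
have qr1 : q r.+1 = ~~ b.
  have : q r.+1 != b by apply: contra pr1 => /eqP qb; rewrite pq //; lia.
  by case: (q r.+1) (b) => [] [].
(* [p'] is [p] with its values at [r] and [r.+1] exchanged, so that the induction hypothesis applies
   with left end [r.+1]. *)
pose p' l := if l == r then ~~ b else if l == r.+1 then b else p l.
have {}IH : commute (bond_braid i j p') (bond_braid r.+1 t q).
  apply: IH; rewrite /p' ?eqxx ?(gtn_eqF (ltnSn r)) //.
    by rewrite !gtn_eqF //; lia.
  by move=> k rk qk; rewrite !gtn_eqF ?pq //; lia.
have p'r : p' r = ~~ b by rewrite /p' eqxx.
have p'r1 : p' r.+1 = b by rewrite /p' eqxx gtn_eqF.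
have pp' l : l != r -> l != r.+1 -> p l = p' l.
  by rewrite /p' => /negbTE-> /negbTE->.
have {pr1} pr1 : p r.+1 = ~~ b by case: (p r.+1) (b) pr1 => [] [].
case: (b) pr qr1 p'r p'r1 pr1 => /= pr qr1 p'r p'r1 pr1.
  rewrite (@bond_braidJl r) ?qr1 //; last lia.
  rewrite -[bond_braid i j p](conjgKV (s r)).
  rewrite (@sigma_bond_swap _ _ p p') //; try lia.
    exact: commuteJ.
  by rewrite pr pr1 p'r p'r1.
rewrite (@bond_braidJVl r) //; last lia.
rewrite -(@sigma_bond_swap _ _ p' p r) //; try lia; first exact: commuteJ.
  by rewrite pr pr1 p'r p'r1.
by move=> l lr lr1; rewrite pp'.
Qed.

(** * The homomorphism and its surjectivity *)

Lemma bond_prod_seq i j J : bond_set i j J ->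
  bond_prod i j [in J] = \prod_(l <- J) A i l.
Proof.
move=> /andP[J_sorted /allP iJj]; rewrite /bond_prod -big_filter.
(* A strictly increasing list with entries in the range is the range filtered by membership. *)
suff -> : [seq l <- index_iota i.+1 j | l \in J] = J by [].
apply: (irr_sorted_eq ltn_trans ltnn) => // [|l].
  by rewrite sorted_filter ?iota_ltn_sorted //; apply: ltn_trans.
by rewrite mem_filter mem_index_iota; case: (boolP (l \in J)) => //= /iJj.
Qed.

Definition letter_braid (x : bb_letter) : braid_group n :=
  match x with
  | Sigma true i => s i
  | Sigma false i => (s i)^-1
  | Bond i j J => bond_braid i j [in J]
  end.

Lemma letter_braid_Bond i j J : bond_set i j J ->
  letter_braid (Bond i j J) =
    (\prod_(l <- J) A i l) * A i j * (\prod_(l <- rev J) (A i l)^-1).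
Proof.
move=> iJj; rewrite /= /bond_braid bond_prod_seq // prodgV revK.
by rewrite /conjg invgK mulgA.
Qed.

Lemma bb_rel_braid u v : bb_rel u v -> all (bb_valid n) u -> all (bb_valid n) v ->
  \prod_(x <- u) letter_braid x = \prod_(x <- v) letter_braid x.
Proof.
case=> {u v}.
- by move=> [] i _ _; rewrite !big_cons !big_nil /= mulg1 ?mulgV ?mulVg.
- move=> i j ij _ _; rewrite !big_cons !big_nil /= !mulg1.
  exact: sigma_commute.
- move=> i /= val _; rewrite !big_cons !big_nil /= !mulg1 !mulgA.
  by apply: sigma_braid; lia.
- move=> i j r t J R ijr rt /= _ _; rewrite !big_cons !big_nil /= !mulg1.
  apply: commute_bond_braid => // k rk; apply/commute_sym/sigma_bond_far; lia.
- move=> i j r t J R irt tj rel /= val _; rewrite !big_cons !big_nil /= !mulg1.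
  case: rel => -[rJ tJ sub].
    apply: (@nested_bond_commute true); rewrite ?inE //; try lia.
    by move=> k rk /sub; rewrite mem_filter => /andP[].
  apply: (@nested_bond_commute false); rewrite ?inE ?(negbTE rJ) ?(negbTE tJ) //;
    try lia.
  move=> k rk kR; apply: contraFF kR => kJ; apply: sub.
  by rewrite mem_filter rk.
- move=> i j J ij /andP[_ /allP iJ] _ _.
  rewrite !big_cons !big_nil /= !mulg1 [RHS]bond_braidJl //.
  by apply/negP => /iJ; lia.
- move=> i j J ij /andP[_ /allP iJ] _ _.
  rewrite !big_cons !big_nil /= !mulg1 [RHS]bond_braidJVl ?inE ?eqxx //.
  (* The added strand [i.+1] is the left end of the shorter bond, hence outside its range. *)
  rewrite /conjg invgK; congr (_ * (_ * _)); apply: eq_bond_braid => l il.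
  by rewrite !inE gtn_eqF //; lia.
- move=> i j J ij /andP[_ /allP iJ] _ /= /andP[val _].
  rewrite !big_cons !big_nil /= !mulg1.
  rewrite [RHS]bond_braidJVr ?/conjg ?invgK //; try lia.
  by apply/negP => /iJ; lia.
- move=> i j J ij /andP[_ /allP iJ] _ /= /andP[val _].
  rewrite !big_cons !big_nil /= !mulg1.
  rewrite [RHS]bond_braidJr ?/conjg ?inE ?mem_rcons ?inE ?eqxx //; try lia.
  congr (_ * (_ * _)); apply: eq_bond_braid => l il.
  by rewrite /= mem_rcons inE ltn_eqF //; lia.
- move=> i _ _; rewrite !big_cons !big_nil /= !mulg1 bond_braidS.
  exact/commuteX/commute_refl.
- move=> i r t R irt /= val _; rewrite !big_cons !big_nil /= !mulg1.
  by apply: sigma_bond_far; lia.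
- move=> i r t R rit iR /= val _; rewrite !big_cons !big_nil /= !mulg1.
  by apply: sigma_bond_commute => //; lia.
- move=> i r t R R' rit iRR' RR' /= val _; rewrite !big_cons !big_nil /= !mulg1.
  rewrite -(@sigma_bond_swap r t [in R] [in R'] i) //; try lia.
  by rewrite /conjg invgK !mulgA mulgVK.
- move=> i /= val _; rewrite !big_cons !big_nil /= !mulg1 !bond_braidS.
  have br : s i * s i.+1 * s i = s i.+1 * s i * s i.+1 by apply: sigma_braid; lia.
  rewrite !expg2 -[LHS]mulgA [s i * (s i.+1 * _)]mulgA br.
  by rewrite !mulgA br.
- move=> i /= val _; rewrite !big_cons !big_nil /= !mulg1 !bond_braidS.
  have br : s i * s i.+1 * s i = s i.+1 * s i * s i.+1 by apply: sigma_braid; lia.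
  by rewrite !expg2 !mulgA br -!mulgA; congr (_ * _); rewrite !mulgA br.
Qed.

(** Writes every class as a product of images of the letters [Sigma], which gives surjectivity. *)
Lemma braid_word_prod (w : seq (braid_index n * bool)) : braid_word w =
  \prod_(x <- w) if x.2 then s (val x.1) else (s (val x.1))^-1.
Proof.
elim: w => [|[k e] w IHw]; first by rewrite big_nil.
rewrite -cat1s braid_word_cat IHw big_cat big_seq1 /= sigma_word.
case: e => //=; congr (_ * _); apply/esym/mulg1_eq; rewrite -braid_word_cat.
exact/word_classP/CongrRel/GroupCancel.
Qed.

Lemma bb_gen_rel_braid (u v : seq (bb_generator n)) : bb_gen_rel u v ->
  \prod_(x <- u) letter_braid (val x) = \prod_(x <- v) letter_braid (val x).
Proof.
move=> uv; rewrite -!(big_map val predT letter_braid); apply: bb_rel_braid => //.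
  by apply/allP => _ /mapP[x _ ->]; exact: valP.
by apply/allP => _ /mapP[x _ ->]; exact: valP.
Qed.

Definition bonded_to_braid :
    UMagmaMorphism.type (bonded_braid_monoid n) (braid_group n) :=
  presented_lift_hom _ _ _ _ bb_gen_rel_braid.

Lemma bonded_to_braid_gen x : bb_valid n x ->
  bonded_to_braid (bb_gen n x) = letter_braid x.
Proof.
move=> xV; rewrite /bb_gen insubT /bonded_to_braid.
exact: etrans (presented_lift_class _ _ _ _ bb_gen_rel_braid _) (big_seq1 _ _ _).
Qed.

Lemma bonded_to_braid_surj y : exists x, bonded_to_braid x = y.
Proof.
rewrite -[y]word_class_repr -/(braid_word _) braid_word_prod.
elim: (repr y) => [|[k e] w [x xE]]; first by exists 1; rewrite big_nil gmulf1.
exists (bb_gen n (Sigma e (val k)) * x); rewrite big_cons gmulfM xE.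
by rewrite bonded_to_braid_gen; [case: e | exact: (valP k)].
Qed.

End BraidRelations.

(** * Counting bonds, and the failure of injectivity *)

Definition is_bond (x : bb_letter) : bool :=
  if x is Bond _ _ _ then true else false.

Lemma bb_rel_count u v : bb_rel u v -> count is_bond u = count is_bond v.
Proof. by case. Qed.

(** The number of bonds descends to the bonded braid monoid, where it separates two elements with
    the same image. *)
Lemma congr_count n (u v : seq (bb_generator n)) :
  congr_closure (@bb_gen_rel n) u v ->
  count is_bond (map val u) = count is_bond (map val v).
Proof.
elim=> {u v} [u v|//|//|u v w _ -> _ -> //|u u' v v' _ uE _ vE].
  exact: bb_rel_count.
by rewrite !map_cat !count_cat uE vE.
Qed.

Theorem theorem4p1 (n : nat) (hn : 2 <= n) :
  exists Phi : UMagmaMorphism.type (bonded_braid_monoid n) (braid_group n),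
    [/\ forall k : nat, 0 < k < n ->
          Phi (bb_gen n (Sigma true k)) = sigma n k /\
          Phi (bb_gen n (Sigma false k)) = (sigma n k)^-1,
        forall i j : nat, 0 < i < j -> j <= n ->
          Phi (bb_gen n (Bond i j [::])) = pure_gen n i j,
        forall (i j : nat) (ls : seq nat), 0 < i < j -> j <= n ->
          bond_set i j ls ->
          Phi (bb_gen n (Bond i j ls)) =
            (\prod_(l <- ls) pure_gen n i l) * pure_gen n i j
            * (\prod_(l <- rev ls) (pure_gen n i l)^-1),
        forall y : braid_group n, exists x : bonded_braid_monoid n, Phi x = y
      & ~ injective Phi].
Proof.
have Phi_bond i j ls : 0 < i < j -> j <= n -> bond_set i j ls ->
    bonded_to_braid n (bb_gen n (Bond i j ls)) =
      (\prod_(l <- ls) pure_gen n i l) * pure_gen n i j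
      * (\prod_(l <- rev ls) (pure_gen n i l)^-1).
  move=> /andP[i0 ij] jn ls_bond.
  by rewrite bonded_to_braid_gen ?letter_braid_Bond //=; apply/and4P.
exists (bonded_to_braid n); split=> //.
- by move=> k kn; rewrite !bonded_to_braid_gen.
- by move=> i j ij jn; rewrite Phi_bond // !big_nil mul1g mulg1.
- exact: bonded_to_braid_surj.
move=> inj.
have s1V : bb_valid n (Sigma true 1) by [].
have b1V : bb_valid n (Bond 1 2 [::]) by rewrite /= hn.
have /inj : bonded_to_braid n (bb_gen n (Bond 1 2 [::])) =
    bonded_to_braid n (bb_gen n (Sigma true 1) * bb_gen n (Sigma true 1)).
  by rewrite gmulfM !bonded_to_braid_gen //= bond_braidS.
(* Injectivity would make the two words congruent, but their bond counts are 1 and 0. *)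
rewrite /bb_gen !insubT [RHS]pm_mul_class => /word_classP.
by move=> /(@congr_count n).
Qed.
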